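(* Let $X\subset\mathbb{R}^n$ be nonempty, compact and convex, let $Y\subset\mathbb{R}^p$, and let $f,g_1,\dots,g_m:\mathbb{R}^n\times\mathbb{R}^p\to\mathbb{R}$ be convex (hence continuous) functions. Consider the convex mixed-integer nonlinear program $$\text{(P)}\qquad \min_{x,y}\ f(x,y)\quad\text{subject to } g_i(x,y)\le 0\ (i=1,\dots,m),\ x\in X,\ y\in Y,$$ and assume that the following Slater constraint qualification holds: for every $y\in Y$ for which there is $x\in X$ with $g_i(x,y)\le 0$ for all $i$, there is $\hat x\in X$ with $g_i(\hat x,y)<0$ for all $i$. Let the data $(x_j,y_j,\alpha_j,\beta_j,\xi_{j,i},\eta_{j,i})$, $j\in T$, and $(x_l,y_l,\xi_{l,i},\eta_{l,i})$, $l\in S$, be chosen as described in the context. Consider the master program $$\text{(MP)}\qquad \min_{x,y,\theta}\ \theta\quad\text{subject to}$$ $$f(x_j,y_j)+\langle\alpha_j,x-x_j\rangle+\langle\beta_j,y-y_j\rangle\le\theta\quad\forall j\in T,$$ $$g_i(x_j,y_j)+\langle\xi_{j,i},x-x_j\rangle+\langle\eta_{j,i},y-y_j\rangle\le 0\quad\forall j\in T,\ i=1,\dots,m,$$ $$g_i(x_l,y_l)+\langle\xi_{l,i},x-x_l\rangle+\langle\eta_{l,i},y-y_l\rangle\le 0\quad\forall l\in S,\ i=1,\dots,m,$$ $$x\in X,\quad y\in Y,\quad \theta\in\mathbb{R}.$$ Then (MP) is equivalent to (P) in the following sense: (P) and (MP) have the same optimal value, and whenever $(\bar x,\bar y)$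 is an optimal solution of (P), the triple $(\bar x,\bar y,\bar\theta)$ with $\bar\theta=f(\bar x,\bar y)$ is an optimal solution of (MP).
   Context: Subdifferential. For a convex function $\varphi:\mathbb{R}^d\to\mathbb{R}$, $\partial\varphi(\bar z)=\{\alpha:\langle\alpha,z-\bar z\rangle\le\varphi(z)-\varphi(\bar z)\ \forall z\}$. For $\phi:\mathbb{R}^n\times\mathbb{R}^p\to\mathbb{R}$ convex, $\partial\phi(\bar x,\bar y)$ is the subdifferential in both variables jointly and $\partial\phi(\cdot,\bar y)(\bar x)$ is the subdifferential at $\bar x$ of $x\mapsto\phi(x,\bar y)$. For $x\in X$, $N(X,x)=\{\gamma\in\mathbb{R}^n:\langle\gamma,z-x\rangle\le 0\ \forall z\in X\}$. $[t]_+=\max\{t,0\}$. The optimal value of a minimization problem is the infimum of the objective over the feasible set ($+\infty$ if the feasible set is empty). Let $\Sigma=\{y\in Y:\exists x\in X,\ g_i(x,y)\le 0\ \forall i\}$. For $y\in Y$, let $P^{y}$ be the problem of minimizing $f(x,y)$ over $x\in X$ with $g_i(x,y)\le0$ for all $i$; it is feasible if and only if $y\in\Sigma$. Feasible data. The points $y_j$, $j\in T$, enumerate $\Sigma$. For each $j\in T$, $x_j$ is a chosen optimal solution of $P^{y_j}$, $I(x_j)=\{i:g_i(x_j,y_j)=0\}$, and $\alpha_j,\beta_j,\xi_{j,i},\eta_{j,i}$ ($i=1,\dots,m$) are chosen such that $(\alpha_j,\beta_j)\in\partial f(x_j,y_j)$, $(\xi_{j,i},\eta_{j,i})\in\partial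 g_i(x_j,y_j)$ for all $i$, and, for some $\lambda_{j,i}\ge 0$, $$-\alpha_j-\sum_{i\in I(x_j)}\lambda_{j,i}\xi_{j,i}\in N(X,x_j).$$ Infeasible data. The points $y_l$, $l\in S$, enumerate $Y\setminus\Sigma$. For each $l\in S$, $J_l\subset\{1,\dots,m\}$ is a chosen subset for which there is $\hat x\in X$ with $g_i(\hat x,y_l)<0$ for all $i\in J_l$; $J_l^{\perp}=\{1,\dots,m\}\setminus J_l$; and $x_l$ is a chosen optimal solution of $$F^{y_l}:\quad\min_x\ \sum_{i\in J_l^\perp}[g_i(x,y_l)]_+\quad\text{subject to } g_i(x,y_l)\le 0\ (i\in J_l),\ x\in X.$$ Put $J_l^1=\{i\in J_l^\perp:g_i(x_l,y_l)=0\}$, $J_l^2=\{i\in J_l^\perp:g_i(x_l,y_l)>0\}$, $J_l^3=\{i\in J_l^\perp:g_i(x_l,y_l)<0\}$. The vectors $\xi_{l,i},\eta_{l,i}$ ($i=1,\dots,m$) are chosen such that $(\xi_{l,i},\eta_{l,i})\in\partial g_i(x_l,y_l)$ for all $i$ and $$-\sum_{i=1}^m\lambda_{l,i}\xi_{l,i}\in N(X,x_l)$$ for some multipliers with $\lambda_{l,i}\ge0$ and $\lambda_{l,i}g_i(x_l,y_l)=0$ for $i\in J_l$, $\lambda_{l,i}\in[0,1]$ for $i\in J_l^1$, $\lambda_{l,i}=1$ for $i\in J_l^2$, and $\lambda_{l,i}=0$ for $i\in J_l^3$. Such choices exist (in the feasible case, under the Slater constraint qualification that for every $y\in\Sigma$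 there is $\hat x\in X$ with $g_i(\hat x,y)<0$ for all $i$). *)

(* Defs.v *)
From HB Require Import structures.
From mathcomp Require Export all_boot all_order all_algebra.
From mathcomp Require Export all_classical all_reals all_analysis.

Set Implicit Arguments.
Unset Strict Implicit.
Unset Printing Implicit Defensive.

Export Order.TTheory GRing.Theory Num.Theory.
Export numFieldNormedType.Exports.

Local Open Scope classical_set_scope.
Local Open Scope ring_scope.

Definition dotv (R : realType) (d : nat) (u v : 'rV[R]_d) : R :=
  \sum_(i < d) u 0 i * v 0 i.

(* ereal_inf set0 = +oo, the value of an infeasible problem. *)
Definition optimal_value (R : realType) (Z : Type) (F : set Z) (obj : Z -> R)
    : \bar R :=
  ereal_inf [set (obj z)%:E | z in F].

Definition optimal_solution (R : realType) (Z : Type) (F : set Z)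
    (obj : Z -> R) (z : Z) : Prop :=
  F z /\ forall w, F w -> obj z <= obj w.

Definition subdifferential (R : realType) (n p : nat)
    (phi : 'rV[R]_n * 'rV[R]_p -> R) (zb : 'rV[R]_n * 'rV[R]_p)
    : set ('rV[R]_n * 'rV[R]_p) :=
  [set s | forall z : 'rV[R]_n * 'rV[R]_p,
    dotv s.1 (z.1 - zb.1) + dotv s.2 (z.2 - zb.2) <= phi z - phi zb].

Definition normal_cone (R : realType) (n : nat) (X : set 'rV[R]_n)
    (x : 'rV[R]_n) : set 'rV[R]_n :=
  [set c | forall z, X z -> dotv c (z - x) <= 0].

Section Problem.
Context {R : realType} {n p m : nat}.
Variables (X : set 'rV[R]_n) (Y : set 'rV[R]_p).
Variables (f : 'rV[R]_n * 'rV[R]_p -> R) (g : 'I_m -> 'rV[R]_n * 'rV[R]_p -> R).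

Definition P_feasible : set ('rV[R]_n * 'rV[R]_p) :=
  [set z | [/\ forall i, g i z <= 0, X z.1 & Y z.2]].

Definition Sigma : set 'rV[R]_p :=
  [set y | Y y /\ exists2 x, X x & forall i, g i (x, y) <= 0].

Definition slater : Prop :=
  forall y, Y y -> (exists2 x, X x & forall i, g i (x, y) <= 0) ->
    exists2 xh, X xh & forall i, g i (xh, y) < 0.

Definition Py_feasible (y : 'rV[R]_p) : set 'rV[R]_n :=
  [set x | X x /\ forall i, g i (x, y) <= 0].

Definition active (x : 'rV[R]_n) (y : 'rV[R]_p) : {set 'I_m} :=
  [set i | g i (x, y) == 0]%SET.

Definition feasible_datum (x : 'rV[R]_n) (y : 'rV[R]_p)
    (alpha : 'rV[R]_n) (beta : 'rV[R]_p)
    (xi : 'I_m -> 'rV[R]_n) (eta : 'I_m -> 'rV[R]_p) : Prop :=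
  [/\ optimal_solution (Py_feasible y) (fun x' => f (x', y)) x,
      subdifferential f (x, y) (alpha, beta),
      forall i, subdifferential (g i) (x, y) (xi i, eta i) &
      exists2 lambda : 'I_m -> R,
        forall i, i \in active x y -> 0 <= lambda i &
        normal_cone X x (- alpha - \sum_(i in active x y) lambda i *: xi i)].

Definition Fy_feasible (J : {set 'I_m}) (y : 'rV[R]_p) : set 'rV[R]_n :=
  [set x | (forall i, i \in J -> g i (x, y) <= 0) /\ X x].

Definition Fy_objective (J : {set 'I_m}) (y : 'rV[R]_p) (x : 'rV[R]_n) : R :=
  \sum_(i in ~: J) Num.max (g i (x, y)) 0.

(* The three implications are the cases J^1, J^2, J^3 of the index partition
   of the complement of J by the sign of g_i(x, y). *)
Definition infeasible_multipliers (J : {set 'I_m}) (x : 'rV[R]_n)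
    (y : 'rV[R]_p) (lambda : 'I_m -> R) : Prop :=
  (forall i, i \in J -> 0 <= lambda i /\ lambda i * g i (x, y) = 0) /\
  (forall i, i \in ~: J ->
    [/\ g i (x, y) = 0 -> 0 <= lambda i <= 1,
        0 < g i (x, y) -> lambda i = 1 &
        g i (x, y) < 0 -> lambda i = 0]).

Definition infeasible_datum (J : {set 'I_m}) (x : 'rV[R]_n) (y : 'rV[R]_p)
    (xi : 'I_m -> 'rV[R]_n) (eta : 'I_m -> 'rV[R]_p) : Prop :=
  [/\ exists2 xh, X xh & forall i, i \in J -> g i (xh, y) < 0,
      optimal_solution (Fy_feasible J y) (Fy_objective J y) x,
      forall i, subdifferential (g i) (x, y) (xi i, eta i) &
      exists2 lambda : 'I_m -> R, infeasible_multipliers J x y lambda &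
        normal_cone X x (- \sum_(i < m) lambda i *: xi i)].

Definition MP_feasible (T S : Type)
    (xT : T -> 'rV[R]_n) (yT : T -> 'rV[R]_p)
    (alpha : T -> 'rV[R]_n) (beta : T -> 'rV[R]_p)
    (xiT : T -> 'I_m -> 'rV[R]_n) (etaT : T -> 'I_m -> 'rV[R]_p)
    (xS : S -> 'rV[R]_n) (yS : S -> 'rV[R]_p)
    (xiS : S -> 'I_m -> 'rV[R]_n) (etaS : S -> 'I_m -> 'rV[R]_p)
    : set ('rV[R]_n * 'rV[R]_p * R) :=
  [set w | let: (x, y, theta) := w in
    [/\ forall j, f (xT j, yT j) + dotv (alpha j) (x - xT j)
                  + dotv (beta j) (y - yT j) <= theta,
        forall j i, g i (xT j, yT j) + dotv (xiT j i) (x - xT j)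
                    + dotv (etaT j i) (y - yT j) <= 0,
        forall l i, g i (xS l, yS l) + dotv (xiS l i) (x - xS l)
                    + dotv (etaS l i) (y - yS l) <= 0,
        X x & Y y]].

End Problem.

(* Main.v *)
(** Subgradient inequalities show that the cuts of (MP) hold at every feasible
    point of (P).  Conversely, fix [y] at the value of one datum: weighting the
    cuts by its KKT multipliers cancels the directional terms up to an element
    of the normal cone, which has the right sign on [X].  At an infeasible [y_l]
    this bounds the optimal value of F^{y_l} by 0, so the cuts exclude
    [y = y_l]; at a feasible [y_j] it forces [theta >= f(x_j, y_j)]. *)
From HB Require Import structures.
Require Import Defs.
From mathcomp Require Import lra.

Set Implicit Arguments.
Unset Strict Implicit.
Unset Printing Implicit Defensive.

Local Open Scope classical_set_scope.
Local Open Scope ring_scope.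

Lemma dotvE (R : realType) (d : nat) (u v : 'rV[R]_d) :
  dotv u v = (u *m v^T) 0 0.
Proof. by rewrite mxE; apply: eq_bigr => i _; rewrite mxE. Qed.

Lemma dotv_is_bilinear (R : realType) (d : nat) :
  bilinear_for *%R *%R (@dotv R d).
Proof.
by split=> w a u v /=;
  rewrite !dotvE ?linearP /= ?mulmxDr ?mulmxDl -?scalemxAr -?scalemxAl !mxE.
Qed.

HB.instance Definition _ (R : realType) (d : nat) :=
  bilinear_isBilinear.Build R 'rV[R]_d 'rV[R]_d R *%R *%R (@dotv R d)
    (dotv_is_bilinear R d).

Lemma sumr_max0_le0 (R : realDomainType) (I : finType) (P : pred I)
    (a : I -> R) :
  \sum_(i | P i) Num.max (a i) 0 <= 0 -> forall i, P i -> a i <= 0.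
Proof.
have max_ge0 i : P i -> 0 <= Num.max (a i) 0 by rewrite le_max lexx orbT.
move=> sum_le0 i Pi; have /eqP sum0 : \sum_(i | P i) Num.max (a i) 0 == 0.
  by rewrite eq_le sum_le0 sumr_ge0.
by rewrite -(psumr_eq0P max_ge0 sum0 Pi) le_max lexx.
Qed.

Section Optimization.
Context {R : realType} {Z W : Type}.
Variables (F : set Z) (G : set W) (a : Z -> R) (b : W -> R).

Lemma le_optimal_value :
  (forall w, G w -> exists2 z, F z & a z <= b w) ->
  (optimal_value F a <= optimal_value G b)%E.
Proof.
move=> GF; apply/ereal_infP => _ [w Gw <-]; apply: ge_ereal_inf.
by have [z Fz le_zw] := GF w Gw; exists (a z)%:E; [exists z | rewrite lee_fin].
Qed.

Lemma optimal_solution_transfer (z : Z) (w : W) :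
  (forall w', G w' -> exists2 z', F z' & a z' <= b w') ->
  optimal_solution F a z -> G w -> b w <= a z -> optimal_solution G b w.
Proof.
move=> GF [_ z_opt] Gw le_wz; split=> // w' /GF[z' /z_opt le_zz' le_zw'].
exact: le_trans le_wz (le_trans le_zz' le_zw').
Qed.

End Optimization.

Section Linearization.
Context {R : realType} {n p : nat}.
Implicit Types (phi : 'rV[R]_n * 'rV[R]_p -> R) (s z : 'rV[R]_n * 'rV[R]_p).

Definition linearization phi z0 s z : R :=
  phi z0 + dotv s.1 (z.1 - z0.1) + dotv s.2 (z.2 - z0.2).

Lemma linearization_le phi z0 s z :
  subdifferential phi z0 s -> linearization phi z0 s z <= phi z.
Proof. by move=> /(_ z); rewrite /linearization; lra. Qed.

Lemma linearization_same_snd phi x0 x y s :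
  linearization phi (x0, y) s (x, y) = phi (x0, y) + dotv s.1 (x - x0).
Proof. by rewrite /linearization /= subrr linear0r addr0. Qed.

End Linearization.

Lemma normal_cone_weighted_cuts_le (R : realType) (n : nat) (X : set 'rV[R]_n)
    (I : Type) (r : seq I) (A : pred I) (lambda a : I -> R)
    (xi : I -> 'rV[R]_n) (c x0 x : 'rV[R]_n) :
  normal_cone X x0 (- c - \sum_(i <- r | A i) lambda i *: xi i) -> X x ->
  (forall i, A i -> 0 <= lambda i) ->
  (forall i, A i -> a i + dotv (xi i) (x - x0) <= 0) ->
  \sum_(i <- r | A i) lambda i * a i <= dotv c (x - x0).
Proof.
move=> /(_ x)/[apply]; rewrite linearBl linearNl linear_sumlz /=.
under eq_bigr do rewrite linearZl_LR.
move=> normal lambda_ge0 cuts.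
suff : \sum_(i <- r | A i) lambda i * a i
       + \sum_(i <- r | A i) lambda i * dotv (xi i) (x - x0) <= 0 by lra.
rewrite -big_split /=; apply: sumr_le0 => i Ai.
by rewrite -mulrDr mulr_ge0_le0 ?lambda_ge0 ?cuts.
Qed.

Section Data.
Context {R : realType} {n p m : nat}.
Variable X : set 'rV[R]_n.
Variables (f : 'rV[R]_n * 'rV[R]_p -> R) (g : 'I_m -> 'rV[R]_n * 'rV[R]_p -> R).

Lemma feasible_datum_linearization_ge x0 y alpha beta xi eta x :
  feasible_datum X f g x0 y alpha beta xi eta -> X x ->
  (forall i, linearization (g i) (x0, y) (xi i, eta i) (x, y) <= 0) ->
  f (x0, y) <= linearization f (x0, y) (alpha, beta) (x, y).
Proof.
move=> [_ _ _ [lambda lambda_ge0 normal]] Xx cuts.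
rewrite linearization_same_snd lerDl.
have := normal_cone_weighted_cuts_le (a := fun i => g i (x0, y))
  normal Xx lambda_ge0.
rewrite big1 => [|i]; last by rewrite inE => /eqP ->; rewrite mulr0.
by apply=> i _; have := cuts i; rewrite linearization_same_snd.
Qed.

Section Multipliers.
Variables (J : {set 'I_m}) (x : 'rV[R]_n) (y : 'rV[R]_p) (lambda : 'I_m -> R).
Hypothesis lambdaP : infeasible_multipliers g J x y lambda.

Lemma infeasible_multipliers_ge0 i : 0 <= lambda i.
Proof.
have [inJ notJ] := lambdaP.
have [iJ|iJ] := boolP (i \in J); first by have [] := inJ i iJ.
have [|eq0 pos neg] := notJ i; first by rewrite inE.
by have [/neg ->|/pos ->|/eq0 /andP[]] := ltgtP (g i (x, y)) 0.
Qed.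

Lemma infeasible_multipliers_mul_max i :
  (i \in J -> g i (x, y) <= 0) ->
  lambda i * g i (x, y) = Num.max (g i (x, y)) 0.
Proof.
have [inJ notJ] := lambdaP; have [iJ|iJ] := boolP (i \in J).
  by have [_ ->] := inJ i iJ => /(_ isT) /max_r.
have [|_ pos neg] := notJ i; first by rewrite inE.
move=> _; have [/[dup] /neg -> ?|/[dup] /pos -> ?|->] := ltgtP (g i (x, y)) 0.
- by rewrite mul0r.
- by rewrite mul1r.
- by rewrite mulr0.
Qed.

End Multipliers.

Lemma infeasible_datum_cuts_feasible (J : {set 'I_m}) x0 y xi eta x :
  infeasible_datum X g J x0 y xi eta -> X x ->
  (forall i, linearization (g i) (x0, y) (xi i, eta i) (x, y) <= 0) ->
  Py_feasible X g y x0.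
Proof.
move=> [_ [[gJ_le0 Xx0] _] _ [lambda lambdaP normal]] Xx cuts; split=> // i.
suff sum_le0 : \sum_(k < m) Num.max (g k (x0, y)) 0 <= 0.
  exact: sumr_max0_le0 sum_le0 i isT.
under eq_bigr do rewrite -(infeasible_multipliers_mul_max lambdaP (gJ_le0 _)).
have normal0 : normal_cone X x0 (- 0 - \sum_(k < m) lambda k *: xi k).
  by rewrite oppr0 add0r.
have := normal_cone_weighted_cuts_le (a := fun k => g k (x0, y)) normal0 Xx.
rewrite linear0l; apply=> k _.
- exact: infeasible_multipliers_ge0 lambdaP _.
- by have := cuts k; rewrite linearization_same_snd.
Qed.

End Data.

Section MasterProgram.
Context {R : realType} {n p m : nat} {T S : Type}.
Variables (X : set 'rV[R]_n) (Y : set 'rV[R]_p).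
Variables (f : 'rV[R]_n * 'rV[R]_p -> R) (g : 'I_m -> 'rV[R]_n * 'rV[R]_p -> R).
Variables (xT : T -> 'rV[R]_n) (yT : T -> 'rV[R]_p).
Variables (alpha : T -> 'rV[R]_n) (beta : T -> 'rV[R]_p).
Variables (xiT : T -> 'I_m -> 'rV[R]_n) (etaT : T -> 'I_m -> 'rV[R]_p).
Variables (xS : S -> 'rV[R]_n) (yS : S -> 'rV[R]_p).
Variables (xiS : S -> 'I_m -> 'rV[R]_n) (etaS : S -> 'I_m -> 'rV[R]_p).

Local Notation MP :=
  (MP_feasible X Y f g xT yT alpha beta xiT etaT xS yS xiS etaS).

Lemma P_feasible_MP_feasible x y :
  (forall j, subdifferential f (xT j, yT j) (alpha j, beta j)) ->
  (forall j i, subdifferential (g i) (xT j, yT j) (xiT j i, etaT j i)) ->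
  (forall l i, subdifferential (g i) (xS l, yS l) (xiS l i, etaS l i)) ->
  P_feasible X Y g (x, y) -> MP (x, y, f (x, y)).
Proof.
move=> f_sub gT_sub gS_sub [/= g_le0 Xx Yy]; split=> // [j|j i|l i].
- exact: linearization_le (x, y) (f_sub j).
- exact: le_trans (linearization_le (x, y) (gT_sub j i)) (g_le0 i).
- exact: le_trans (linearization_le (x, y) (gS_sub l i)) (g_le0 i).
Qed.

Lemma MP_feasible_Sigma (J : S -> {set 'I_m}) x y theta :
  Y `\` Sigma X Y g `<=` range yS ->
  (forall l, infeasible_datum X g (J l) (xS l) (yS l) (xiS l) (etaS l)) ->
  MP (x, y, theta) -> Sigma X Y g y.
Proof.
move=> yS_onto data [_ _ cuts Xx Yy]; apply: contrapT => nSy.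
have [l _ yl] := yS_onto y (conj Yy nSy); subst y.
have [XxS gxS] := infeasible_datum_cuts_feasible (data l) Xx (cuts l).
by apply: nSy; split=> //; exists (xS l).
Qed.

Lemma MP_feasible_P_feasible x y theta :
  Sigma X Y g `<=` range yT ->
  (forall j, feasible_datum X f g (xT j) (yT j) (alpha j) (beta j)
    (xiT j) (etaT j)) ->
  MP (x, y, theta) -> Sigma X Y g y ->
  exists2 z, P_feasible X Y g z & f z <= theta.
Proof.
move=> yT_onto data [fcut gcuts _ Xx Yy] /yT_onto[j _ yj]; subst y.
have [[[XxT gxT] _] _ _ _] := data j.
exists (xT j, yT j); first by split.
apply: le_trans (fcut j).
exact: feasible_datum_linearization_ge (data j) Xx (gcuts j).
Qed.

End MasterProgram.

Theorem theorem3p5 (R : realType) (n p m : nat)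
  (X : set 'rV[R]_n) (Y : set 'rV[R]_p)
  (f : 'rV[R]_n * 'rV[R]_p -> R) (g : 'I_m -> 'rV[R]_n * 'rV[R]_p -> R)
  (X_neq0 : X !=set0) (X_compact : compact X)
  (X_convex : convex_set (M := 'rV[R]_n) X)
  (f_convex : convex_function (E := ('rV[R]_n * 'rV[R]_p)%type) setT f)
  (g_convex : forall i : 'I_m,
     convex_function (E := ('rV[R]_n * 'rV[R]_p)%type) setT (g i))
  (slaterCQ : slater X Y g)
  (T S : Type)
  (xT : T -> 'rV[R]_n) (yT : T -> 'rV[R]_p)
  (alpha : T -> 'rV[R]_n) (beta : T -> 'rV[R]_p)
  (xiT : T -> 'I_m -> 'rV[R]_n) (etaT : T -> 'I_m -> 'rV[R]_p)
  (yT_enum : range yT = Sigma X Y g)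
  (feasible_data : forall j : T,
     feasible_datum X f g (xT j) (yT j) (alpha j) (beta j) (xiT j) (etaT j))
  (J : S -> {set 'I_m})
  (xS : S -> 'rV[R]_n) (yS : S -> 'rV[R]_p)
  (xiS : S -> 'I_m -> 'rV[R]_n) (etaS : S -> 'I_m -> 'rV[R]_p)
  (yS_enum : range yS = Y `\` Sigma X Y g)
  (infeasible_data : forall l : S,
     infeasible_datum X g (J l) (xS l) (yS l) (xiS l) (etaS l)) :
  let P := P_feasible X Y g in
  let MP := MP_feasible X Y f g xT yT alpha beta xiT etaT xS yS xiS etaS in
  let obj_MP := fun w : 'rV[R]_n * 'rV[R]_p * R => w.2 in
  optimal_value P f = optimal_value MP obj_MP /\
  (forall (xb : 'rV[R]_n) (yb : 'rV[R]_p),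
     optimal_solution P f (xb, yb) ->
     optimal_solution MP obj_MP (xb, yb, f (xb, yb))).
Proof.
move=> P MP obj_MP.
have P_MP z : P z -> MP (z, f z).
  case: z => x y; apply: P_feasible_MP_feasible => [j|j|l].
  - by case: (feasible_data j).
  - by case: (feasible_data j).
  - by case: (infeasible_data l).
have MP_P w : MP w -> exists2 z, P z & f z <= obj_MP w.
  case: w => -[x y] theta MPw.
  have Sy : Sigma X Y g y.
    by apply: MP_feasible_Sigma infeasible_data MPw; rewrite yS_enum.
  by apply: MP_feasible_P_feasible feasible_data MPw Sy; rewrite yT_enum.
split; last first.
  move=> xb yb opt.
  by apply: optimal_solution_transfer MP_P opt (P_MP _ opt.1) _.
apply/eqP; rewrite eq_le !le_optimal_value // => z Pz.
by exists (z, f z) => //; exact: P_MP.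
Qed.
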